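(* Let $A$ and $B$ be nonempty closed convex subsets of $X$ with $A\cap B\neq\varnothing$. Then for every starting point $b_{-1}\in X$, the sequences $(a_n)_{n\in\mathbb N}$ and $(b_n)_{n\in\mathbb N}$ generated by the method of alternating projections with respect to $(A,B)$ converge to some point in $A\cap B$. The convergence of these sequences is linear provided that $\operatorname{ri}A\cap\operatorname{ri}B\neq\varnothing$.
   Context: $X$ is a Euclidean space (finite-dimensional real Hilbert space) with norm $\|\cdot\|$; $\mathbb N=\{0,1,2,\dots\}$. $\operatorname{ri}S$ denotes the relative interior of $S$ (interior relative to the affine hull). $P_A,P_B$ are the projections (nearest point maps) onto $A$ and $B$. The method of alternating projections with starting point $b_{-1}$ generates $a_n=P_A(b_{n-1})$ and $b_n=P_B(a_n)$ for $n\in\mathbb N$. A sequence $(x_n)$ converges linearly to $\bar x$ if there are $\gamma\in[0,1[$ and $\mu\geq0$ with $\|x_n-\bar x\|\leq\mu\gamma^n$ for all $n\in\mathbb N$. *)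

(* Defs.v *)
From HB Require Import structures.
From mathcomp Require Import all_boot all_order all_algebra.
From mathcomp Require Import all_classical all_reals all_analysis.

Set Implicit Arguments.
Unset Strict Implicit.
Unset Printing Implicit Defensive.

Import Order.TTheory GRing.Theory Num.Theory.
Import numFieldNormedType.Exports.

Local Open Scope classical_set_scope.
Local Open Scope ring_scope.

#[short(type="normedVectType")]
HB.structure Definition NormedVector (K : numFieldType) :=
  {V of NormedModule K V & Vector K V}.

(* A Euclidean space is a [normedVectType R] (finite dimension comes from
   [vectType]) together with an inner product inducing its norm. *)
Definition induces_norm (R : realType) (X : normedVectType R)
    (dot : {dot X for idfun}) :=
  forall x : X, `|x| = Num.sqrt (dot x x).

Definition affine_set (R : realType) (X : lmodType R) (M : set X) :=
  forall (x y : X) (t : R), M x -> M y -> M ((1 - t) *: x + t *: y).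

Definition affine_hull (R : realType) (X : lmodType R) (S : set X) : set X :=
  smallest (@affine_set R X) S.

(* In [subspace D] the points outside [D] are isolated; this is harmless here
   because [S] is contained in its affine hull. *)
Definition relative_interior (R : realType) (X : normedModType R)
    (S : set X) : set X :=
  interior (S : set (subspace (affine_hull S))).

Definition nearest_point (R : realType) (X : normedModType R)
    (S : set X) (x p : X) :=
  S p /\ forall q : X, S q -> `|x - p| <= `|x - q|.

(* The default value [0] is used only when [x] has no nearest point in [S]. *)
Definition proj (R : realType) (X : normedModType R) (S : set X) (x : X) : X :=
  xget 0 [set p | nearest_point S x p].

(* [b0] is the starting point, denoted b_{-1} in the usual indexing. *)
Definition alternating_projections (R : realType) (X : normedModType R)
    (A B : set X) (b0 : X) (a b : nat -> X) :=
  [/\ a 0%N = proj A b0,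
      forall n, a n.+1 = proj A (b n) &
      forall n, b n = proj B (a n)].

Definition cvg_linearly (R : realType) (X : normedModType R)
    (u : nat -> X) (l : X) :=
  exists gamma mu : R, [/\ 0 <= gamma, gamma < 1, 0 <= mu &
    forall n, `|u n - l| <= mu * gamma ^+ n].

(* Main.v *)
Require Import Defs.
From HB Require Import structures.
From mathcomp Require Import all_boot all_order all_algebra.
From mathcomp Require Import all_classical all_reals all_analysis.
From mathcomp Require Import ring lra.

Set Implicit Arguments.
Unset Strict Implicit.
Unset Printing Implicit Defensive.

Import Order.TTheory GRing.Theory Num.Theory.
Import numFieldNormedType.Exports VectorInternalTheory.

Local Open Scope classical_set_scope.
Local Open Scope ring_scope.

(** Interleave the two sequences into one sequence z, so that each term lies in
one of the two sets and the next term is its nearest point in the other.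

Convergence.  The projection p of x onto a closed convex set satisfies
|p - c|^2 + |x - p|^2 <= |x - c|^2 for every c in that set
([nearest_point_pythagoras]).  Applied with c in C = A `&` B, which lies in both
sets, this says that each step of z brings it closer to every point of C, and
that the gain controls the length of the step.  Hence z is bounded and
its steps tend to 0.  In finite dimension z has a cluster point; since
consecutive terms are close and one of them lies in A, the other in B, the
cluster point belongs to C.  The distance from z to it is nonincreasing and
comes arbitrarily close to 0, so z converges ([alternating_cvg]).

Rate.  Suppose that there is k with d(z_n, C) <= k |z_n - z_{n+1}| for all n.
Then the Pythagorean inequality at the nearest point of C to z_n shows that
d(z_n, C) shrinks at each step by a factor below 1, and |z_n - lim z| is at most
2 d(z_n, C) because z never moves away from a point of C
([square_decrease_linear]).

The constant k comes from a common relative interior point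
([relative_interior_regularity]).  Let y0 be that point, and let U and V be the
directions of the affine hulls of A and B.  For x in A and y in B the difference
y - x lies in U + V; split it as u + v with |u| and |v| at most K |y - x|.  The
points x + u and y - v coincide, but may lie outside A and B.  Shrinking this
common point towards y0 by a factor s = d / (d + K |y - x|), where d is
the radius of relative balls around y0 in A and in B, repairs that: the result
is a convex combination of x and y0 + (d / (K |y - x|)) u, hence in A, and
likewise in B.  It is at distance O(|y - x|) from y as long as y stays bounded.
*)

(** * Inner product and finite dimension *)

Section InnerProduct.
Context (R : realType) (X : normedVectType R) (dot : {dot X for idfun}).

Lemma dotC (x y : X) : dot x y = dot y x.
Proof. by rewrite hermC expr0 mul1r. Qed.

Lemma dotDr (x y z : X) : dot x (y + z) = dot x y + dot x z.
Proof. by rewrite linearDr. Qed.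

Lemma dotZr (k : R) (x y : X) : dot x (k *: y) = k * dot x y.
Proof. by rewrite linearZr_LR. Qed.

Lemma dotDl (x y z : X) : dot (x + y) z = dot x z + dot y z.
Proof. by rewrite !(dotC _ z) dotDr. Qed.

Lemma dotZl (k : R) (x y : X) : dot (k *: x) y = k * dot x y.
Proof. by rewrite !(dotC _ y) dotZr. Qed.

Lemma dot_sumr n (x : X) (y : 'I_n -> X) :
  dot x (\sum_i y i) = \sum_i dot x (y i).
Proof. exact: linear_sum. Qed.

Lemma dot_ge0 (x : X) : 0 <= dot x x.
Proof.
have [->|/neq0_dnorm_gt0/ltW//] := eqVneq x 0.
by rewrite linear0r.
Qed.

Hypothesis dot_norm : induces_norm dot.

Lemma dotxx (x : X) : dot x x = `|x| ^+ 2.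
Proof. by rewrite dot_norm sqr_sqrtr// dot_ge0. Qed.

Lemma sqr_normD (x y : X) :
  `|x + y| ^+ 2 = `|x| ^+ 2 + 2 * dot x y + `|y| ^+ 2.
Proof. rewrite -!dotxx dotDl !dotDr (dotC y x); ring. Qed.

(** Cauchy-Schwarz comes for free from the triangle inequality, since the inner
product is given together with the norm that it induces. *)
Lemma dot_le (x y : X) : dot x y <= `|x| * `|y|.
Proof.
have : `|x + y| ^+ 2 <= (`|x| + `|y|) ^+ 2.
  by rewrite lerXn2r ?nnegrE ?addr_ge0// ler_normD.
by rewrite sqr_normD sqrrD; lra.
Qed.

Lemma normr_dot_le (x y : X) : `|dot x y| <= `|x| * `|y|.
Proof.
rewrite ler_norml dot_le andbT lerNl -(normrN x) -mulN1r -dotZl scaleN1r.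
exact: dot_le.
Qed.

(** Riesz representation of the coordinate forms.  The Gram matrix of a basis is
invertible by definiteness, and it turns coordinates into inner products with the
basis vectors. *)
Lemma coord_dot n (e : n.-tuple X) : basis_of fullv e ->
  forall i, exists g : X, forall x, coord e i x = dot x g.
Proof.
move=> e_basis i.
pose G : 'M[R]_n := \matrix_(i, j) dot e`_i e`_j.
pose comb (v : 'rV[R]_n) := \sum_j v 0 j *: e`_j.
have dot_comb v j : (v *m G) 0 j = dot (comb v) e`_j.
  rewrite dotC dot_sumr !mxE; apply: eq_bigr => k _.
  by rewrite dotZr mxE (dotC e`_j).
have G_unit : G \in unitmx.
  rewrite -row_free_unit; apply: inj_row_free => v vG0.
  have comb0 : comb v = 0.
    apply: contra_eq (erefl (dot (comb v) (comb v))) => cv0.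
    rewrite [X in _ != X](_ : _ = 0) ?gt_eqF ?neq0_dnorm_gt0//.
    rewrite {2}/comb dot_sumr big1// => j _.
    by rewrite dotZr -dot_comb vG0 mxE mulr0.
  apply/rowP => j; rewrite mxE.
  exact: (freeP (basis_free e_basis) (v 0) comb0).
exists (\sum_j invmx G j i *: e`_j) => x.
pose c : 'rV[R]_n := \row_j coord e j x.
have xE : x = comb c.
  rewrite {1}(coord_basis e_basis (memvf x)).
  by apply: eq_bigr => j _; rewrite mxE.
rewrite dot_sumr; transitivity (c 0 i); first by rewrite mxE.
rewrite -[c](mulmxK G_unit) mxE; apply: eq_bigr => j _.
by rewrite dot_comb -xE dotZr mulrC.
Qed.

(** By the previous lemma and Cauchy-Schwarz, the coordinates of [x] are bounded
by multiples of its norm.  This gives both the compactness below and the bounded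
splitting along a sum of subspaces. *)
Lemma linear_bound (W : normedModType R) (f : {linear X -> W}) :
  exists2 K, 0 < K & forall x, `|f x| <= K * `|x|.
Proof.
have [g gE] := choice (coord_dot (vbasisP fullv)).
pose e := vbasis (@fullv R X).
exists (1 + \sum_i `|g i| * `|f e`_i|) => [|x].
  by rewrite ltr_wpDr// sumr_ge0// => i _; rewrite mulr_ge0.
rewrite mulrDl mul1r ler_wpDl// {1}(coord_vbasis (memvf x)) linear_sum.
rewrite (le_trans (ler_norm_sum _ _ _))// mulr_suml ler_sum// => i _.
rewrite linearZ normrZ gE mulrAC ler_wpM2r//.
by rewrite mulrC normr_dot_le.
Qed.

(** Heine-Borel, transported from row vectors: [r2v] is continuous, and the
preimage of a bounded set is bounded because the inverse [v2r] is a linear map on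
[X]. *)
Lemma bounded_closed_compact_vect (S : set X) (r : R) :
  closed S -> (forall x, S x -> `|x| <= r) -> compact S.
Proof.
move=> S_closed S_bounded.
pose f : 'rV[R]_(dim X) -> X := r2v.
have f_cont : continuous f.
  pose e j := f (delta_mx 0 j).
  have -> : f = fun v => \sum_j v 0 j *: e j.
    apply/funext => v; rewrite /f {1}(row_sum_delta v) linear_sum.
    by apply: eq_bigr => j _; rewrite linearZ.
  apply: continuous_big => [|j _ v]; first exact: add_continuous.
  exact: (cvgZ (@coord_continuous R 1 (dim X) 0 j v) (cvg_cst (e j))).
have [K K0 v2r_le] := linear_bound v2r.
have -> : S = f @` (f @^-1` S).
  apply/seteqP; split => [x Sx|_ [v Sv <-]//].
  by exists (v2r x); rewrite /= /f v2rK.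
apply: continuous_compact; first exact: continuous_subspaceT.
apply: bounded_closed_compact; last by apply: preimage_closed.
exists (K * r); split; first exact: num_real.
move=> M rM v Sv; apply: le_trans (ltW rM).
have vE : v2r (f v) = v by exact: r2vK.
rewrite -vE; apply: le_trans (v2r_le _) _.
by rewrite ler_wpM2l ?(ltW K0)//; exact: S_bounded.
Qed.

End InnerProduct.

(** * Projection onto a closed convex set *)

Lemma convex_setP (R : numDomainType) (V : lmodType R) (S : set V) :
  convex_set S -> forall x y t, S x -> S y -> 0 <= t -> t <= 1 ->
  S (t *: x + (1 - t) *: y).
Proof.
move=> S_convex x y t Sx Sy t0 t1.
by have := S_convex x y (Itv01 t0 t1) (mem_set Sx) (mem_set Sy); rewrite inE.
Qed.

Lemma dist_continuous (R : realType) (X : normedModType R) (x : X) :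
  continuous (fun y : X => `|x - y|).
Proof.
move=> y; apply: (@cvg_norm _ X).
by apply: (@cvgB _ X); [exact: cvg_cst | exact: cvg_id].
Qed.

Lemma closed_dist_le (R : realType) (X : normedModType R) (x : X) (r : R) :
  closed [set y | `|x - y| <= r].
Proof.
apply: (@preimage_closed _ _ _ [set t : R | t <= r]) => [y _|].
  exact: dist_continuous.
exact: closed_le.
Qed.

Section Projection.
Context (R : realType) (X : normedVectType R) (dot : {dot X for idfun}).
Hypothesis dot_norm : induces_norm dot.

(** It suffices to minimize the distance over the part of [S] not farther from
[x] than some chosen point of [S]; this part is compact. *)
Lemma nearest_point_exists (S : set X) (x : X) :
  closed S -> S !=set0 -> exists p, nearest_point S x p.
Proof.
move=> S_closed [q0 Sq0]; pose r := `|x - q0|.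
pose T := S `&` [set y | `|x - y| <= r].
have T_compact : compact T.
  apply: (bounded_closed_compact_vect dot_norm (r := r + `|x|)).
    by apply: closedI => //; exact: closed_dist_le.
  move=> y [_ /= xy]; rewrite -[y](subKr x) (le_trans (ler_normB _ _))//.
  by rewrite addrC lerD2r.
have Tq0 : T q0 by split => //=.
have [||p /set_mem[Sp xp] p_min] :=
    @compact_EVT_min _ _ (fun y => `|x - y|) T _ T_compact.
- by exists q0.
- exact: continuous_subspaceT (@dist_continuous R X x).
exists p; split => // q Sq.
have [xq|/ltW rxq] := leP `|x - q| r; first by apply: p_min; rewrite inE.
exact: le_trans xp rxq.
Qed.

Lemma proj_nearest (S : set X) (x : X) :
  closed S -> S !=set0 -> nearest_point S x (Defs.proj S x).
Proof.
by move=> S_closed S0; apply: xgetPex; exact: nearest_point_exists.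
Qed.

(** First-order optimality: otherwise moving from [p] slightly towards [q], inside
[S], would decrease the distance to [x]. *)
Lemma nearest_point_obtuse (S : set X) (x p q : X) :
  convex_set S -> nearest_point S x p -> S q -> dot (x - p) (p - q) >= 0.
Proof.
move=> S_convex [Sp p_min] Sq; rewrite leNgt; apply/negP => d_lt0.
set d := dot (x - p) (p - q) in d_lt0.
pose N := `|p - q| ^+ 2; have N_ge0 : 0 <= N by rewrite exprn_ge0.
have Nd_gt0 : 0 < N - d by lra.
(* This [t] lies in ]0, 1] and keeps the quadratic term [t * N] below [- d]. *)
pose t := - d / (N - d).
have t_gt0 : 0 < t by rewrite divr_gt0// oppr_gt0.
have t_le1 : t <= 1 by rewrite ler_pdivrMr//; lra.
have := p_min _ (convex_setP S_convex Sq Sp (ltW t_gt0) t_le1).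
rewrite [X in _ <= `|X|](_ : _ = (x - p) + t *: (p - q)); last first.
  by rewrite scalerBr scalerBl scale1r !opprD opprK (addrC (- (t *: q))) !addrA.
rewrite -ler_sqr ?nnegrE// (sqr_normD dot_norm (x - p)) (dotZr dot) -/d.
rewrite normrZ gtr0_norm// exprMn -/N.
have -> : t ^+ 2 * N = t * (t * N) by ring.
have tN : t * N <= - d.
  by rewrite /t mulrAC ler_pdivrMr// ler_pM2l ?oppr_gt0//; lra.
by nra.
Qed.

(** The angle at [p] being obtuse, the law of cosines gives an inequality; its
term [`|x - p| ^+ 2] is what makes each projection a quantitative gain. *)
Lemma nearest_point_pythagoras (S : set X) (x p q : X) :
  convex_set S -> nearest_point S x p -> S q ->
  `|p - q| ^+ 2 + `|x - p| ^+ 2 <= `|x - q| ^+ 2.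
Proof.
move=> S_convex p_near Sq; have := nearest_point_obtuse S_convex p_near Sq.
rewrite (_ : x - q = (x - p) + (p - q)); last by rewrite addrA subrK.
by rewrite (sqr_normD dot_norm (x - p) (p - q)); lra.
Qed.

End Projection.

(** * Sequences that approach every point of a set *)

Definition fejer_monotone (R : realType) (X : normedModType R) (C : set X)
    (z : nat -> X) :=
  forall c n, C c -> `|z n.+1 - c| <= `|z n - c|.

Section FejerMonotone.
Context (R : realType) (X : normedModType R) (C : set X) (z : nat -> X).
Hypothesis z_fejer : fejer_monotone C z.

Lemma fejer_le (c : X) m n : C c -> (m <= n)%N -> `|z n - c| <= `|z m - c|.
Proof.
move=> Cc /subnKC <-; elim: (n - m)%N => [|k IHk]; first by rewrite addn0.
by rewrite addnS (le_trans _ IHk)// z_fejer.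
Qed.

(** For each [e], coming within [e] of [w] once is enough, because the distance
to [w] never increases afterwards. *)
Lemma fejer_cvg (w : X) : C w ->
  (forall e, 0 < e -> exists n, `|z n - w| < e) -> z @ \oo --> w.
Proof.
move=> Cw z_near; apply/cvgrPdist_lt => e /z_near[m zm].
exists m => // n /= mn; rewrite distrC.
exact: le_lt_trans (fejer_le Cw mn) zm.
Qed.

(** All later terms, hence also the limit, stay in the ball around [c] of radius
[`|z n - c|].  With [c] nearest to [z n], the distance to [C] controls the
distance to the limit. *)
Lemma fejer_lim_dist (w c : X) n : z @ \oo --> w -> C c ->
  `|z n - w| <= 2 * `|z n - c|.
Proof.
move=> z_w Cc.
suff wc : `|w - c| <= `|z n - c|.
  rewrite (le_trans (ler_distD c _ _))// mulrDl mul1r lerD2l distrC//.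
apply/ler_addgt0Pr => e e0.
have /cvgrPdist_le/(_ e e0)[M _ zM] := z_w.
rewrite (le_trans (ler_distD (z (maxn M n)) _ _))// addrC lerD//.
  by rewrite fejer_le// leq_maxr.
by apply: zM => /=; rewrite leq_maxl.
Qed.

End FejerMonotone.

Section SquareDecrease.
Context (R : realType) (X : normedModType R) (C : set X) (z : nat -> X).
Hypothesis z_step : forall c n, C c ->
  `|z n.+1 - c| ^+ 2 + `|z n - z n.+1| ^+ 2 <= `|z n - c| ^+ 2.

Lemma square_decrease_fejer : fejer_monotone C z.
Proof.
move=> c n Cc; rewrite -ler_sqr ?nnegrE//.
by have := z_step n Cc; have := sqr_ge0 `|z n - z n.+1|; lra.
Qed.

(** The squared steps are bounded by the decrements of the convergent sequence of
squared distances to a point of [C]. *)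
Lemma square_decrease_steps (e : R) : C !=set0 -> 0 < e ->
  \forall n \near \oo, `|z n - z n.+1| < e.
Proof.
move=> [c Cc] e0; pose u n := `|z n - c| ^+ 2.
have u_cvg : cvgn u.
  apply: nonincreasing_is_cvgn.
    apply/nonincreasing_seqP => n.
    by rewrite lerXn2r ?nnegrE//; exact: square_decrease_fejer.
  by exists 0 => _ [n _ <-]; exact: sqr_ge0.
have u_shift : u n.+1 @[n --> \oo] --> limn u by rewrite cvg_shiftS.
have : (u n - u n.+1) @[n --> \oo] --> limn u - limn u by exact: cvgB.
rewrite subrr => /cvgrPdist_lt/(_ (e ^+ 2))[|M _ uM]; first exact: exprn_gt0.
exists M => // n /uM /=; rewrite sub0r normrN => un.
rewrite -ltr_sqr ?nnegrE// ?(ltW e0)//.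
apply: le_lt_trans un; rewrite (le_trans _ (ler_norm _))//.
by have := z_step n Cc; rewrite /u; lra.
Qed.

(** With D_n the distance from [z n] to [C], the hypotheses give
D_(n+1)^2 <= D_n^2 - |step|^2 and D_n <= k |step|, so D_n decreases
geometrically; the distance to the limit is at most 2 D_n. *)
Lemma square_decrease_linear (w : X) (k : R) :
  (forall n, exists p, nearest_point C (z n) p) ->
  (forall n, exists2 c, C c & `|z n - c| <= k * `|z n - z n.+1|) ->
  z @ \oo --> w -> cvg_linearly z w.
Proof.
move=> /choice[p p_near] k_regular z_w.
pose K := Num.max 1 k; have K_ge1 : 1 <= K by rewrite le_max lexx.
have K2_gt0 : 0 < K ^+ 2 by rewrite exprn_gt0// (lt_le_trans ltr01).
(* The factor [1 - s] avoids a square root: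
   [1 - K ^- 2 = 1 - 2 * s <= (1 - s) ^+ 2]. *)
pose s := (2 * K ^+ 2)^-1.
have s_gt0 : 0 < s by rewrite invr_gt0 mulr_gt0.
have sK : 2 * s * K ^+ 2 = 1.
  by rewrite /s; field; rewrite gt_eqF// (lt_le_trans ltr01).
have s_le1 : s <= 1.
  by rewrite invf_le1 ?mulr_gt0//; have := exprn_ege1 2 K_ge1; lra.
pose D n := `|z n - p n|.
have D_ge0 n : 0 <= D n by exact: normr_ge0.
have K_ge0 : 0 <= K by exact: le_trans ler01 K_ge1.
have D_step n : D n.+1 <= (1 - s) * D n.
  have D_reg : D n <= K * `|z n - z n.+1|.
    have [c Cc zc] := k_regular n.
    apply: le_trans ((p_near n).2 _ Cc) (le_trans zc _).
    by rewrite ler_wpM2r// le_max lexx orbT.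
  have D_sqr : D n ^+ 2 <= K ^+ 2 * `|z n - z n.+1| ^+ 2.
    by rewrite -exprMn lerXn2r ?nnegrE ?D_ge0 ?mulr_ge0.
  have D_next : D n.+1 ^+ 2 <= `|z n.+1 - p n| ^+ 2.
    by rewrite lerXn2r ?nnegrE//; apply: (p_near n.+1).2; exact: (p_near n).1.
  have := z_step n (p_near n).1; rewrite -/(D n) => z_n.
  rewrite -ler_sqr ?nnegrE ?mulr_ge0 ?subr_ge0// exprMn.
  have sD : 2 * s * D n ^+ 2 <= `|z n - z n.+1| ^+ 2.
    rewrite -[leRHS]mul1r -[X in _ <= X * _]sK -[leRHS]mulrA ler_wpM2l//.
    by rewrite mulr_ge0// ltW.
  have := mulr_ge0 (sqr_ge0 s) (sqr_ge0 (D n)); nra.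
have D_geom n : D n <= D 0%N * (1 - s) ^+ n.
  elim: n => [|n IHn]; first by rewrite expr0 mulr1.
  rewrite (le_trans (D_step n))// exprS mulrCA ler_wpM2l ?subr_ge0//.
exists (1 - s), (2 * D 0%N); split.
- by rewrite subr_ge0.
- by rewrite gtrBl.
- by rewrite mulr_ge0.
- move=> n; rewrite -mulrA.
  apply: le_trans (fejer_lim_dist square_decrease_fejer n z_w (p_near n).1) _.
  by apply: ler_wpM2l => //; exact: D_geom.
Qed.

End SquareDecrease.

(** * Sequences alternating between two closed sets *)

Section AlternatingPoints.
Context (R : realType) (X : normedVectType R) (dot : {dot X for idfun}).
Hypothesis dot_norm : induces_norm dot.
Context (A B : set X) (z : nat -> X).
Hypotheses (A_closed : closed A) (B_closed : closed B).
Hypothesis z_alt : forall n, A (z n) /\ B (z n.+1) \/ B (z n) /\ A (z n.+1).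
Hypothesis AB_neq0 : A `&` B !=set0.
Hypothesis z_step : forall c n, (A `&` B) c ->
  `|z n.+1 - c| ^+ 2 + `|z n - z n.+1| ^+ 2 <= `|z n - c| ^+ 2.

Lemma cluster_eventually_dist (w : X) m (e : R) :
  cluster (z @ \oo) w -> 0 < e -> exists2 n, (m <= n)%N & `|z n - w| < e.
Proof.
move=> w_clust e0.
have [] := w_clust (z @` [set n | (m <= n)%N]) (ball w e).
- by exists m => // n /= mn; exists n.
- exact: nbhsx_ballx.
move=> _ [[n /= mn <-]]; rewrite -ball_normE /= distrC => zn.
by exists n.
Qed.

Lemma bounded_cluster (c : X) (r : R) :
  (forall n, `|z n - c| <= r) -> exists w, cluster (z @ \oo) w.
Proof.
move=> z_le.
have T_compact : compact [set x : X | `|c - x| <= r].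
  apply: (bounded_closed_compact_vect dot_norm (r := r + `|c|)).
    exact: closed_dist_le.
  move=> x /= cx; rewrite -[x](subKr c) (le_trans (ler_normB _ _))//.
  by rewrite addrC lerD2r.
have [|w [_ w_clust]] := T_compact (z @ \oo) _; last by exists w.
by exists 0%N => // n _ /=; rewrite distrC; exact: z_le.
Qed.

(** Near a cluster point [w] there is a term [z n] followed by a short step, so
both [z n] and [z n.+1] are close to [w], and one of them lies in [S]. *)
Lemma cluster_mem (S : set X) (w : X) : closed S ->
  (forall n, S (z n) \/ S (z n.+1)) -> cluster (z @ \oo) w -> S w.
Proof.
move=> S_closed zS w_clust; apply: S_closed => V /nbhs_ballP[e /= e0 eV].
have e20 : 0 < e / 2 by rewrite divr_gt0.
have [M _ z_close] := square_decrease_steps z_step AB_neq0 e20.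
have [n Mn zn] := cluster_eventually_dist M w_clust e20.
have zn1 : `|z n.+1 - w| < e.
  rewrite (le_lt_trans (ler_distD (z n) _ _))// [ltRHS](splitr e) ltrD//.
  by rewrite distrC; exact: z_close.
have zn' : `|z n - w| < e by rewrite (lt_trans zn)// ltr_pdivrMr// ltr_pMr// ltr1n.
by case: (zS n) => Szn; [exists (z n) | exists (z n.+1)]; split => //;
  apply: eV; rewrite -ball_normE /= distrC.
Qed.

Lemma alternating_cvg : exists2 w, (A `&` B) w & z @ \oo --> w.
Proof.
have z_fejer := square_decrease_fejer z_step.
have [c Cc] := AB_neq0.
have [w w_clust] := bounded_cluster (fun n => fejer_le z_fejer Cc (leq0n n)).
have ABw : (A `&` B) w.
  split; apply: (cluster_mem _ _ w_clust) => // n.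
    by case: (z_alt n) => -[? ?]; [left | right].
  by case: (z_alt n) => -[? ?]; [right | left].
exists w => //; apply: (fejer_cvg z_fejer ABw) => e e0.
by have [n _ zn] := cluster_eventually_dist 0 w_clust e0; exists n.
Qed.

End AlternatingPoints.

(** * Regularity of sets with a common relative interior point *)

(** Take a subspace of largest dimension among those contained in [L]: adjoining
to it a vector of [L] would otherwise increase the dimension. *)
Lemma submod_vspace (K : fieldType) (V : vectType K) (L : set V) :
  L 0 -> (forall k x y, L x -> L y -> L (k *: x + y)) ->
  exists U : {vspace V}, forall x, x \in U <-> L x.
Proof.
move=> L0 L_lin.
pose P n := `[< exists U : {vspace V}, {in U, forall x, L x} /\ \dim U = n >].
have P_ex : exists n, P n.
  exists 0%N; apply/asboolP; exists 0%VS; split; last exact: dimv0.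
  by move=> x; rewrite memv0 => /eqP ->.
have P_le n : P n -> (n <= \dim (@fullv K V))%N.
  by move=> /asboolP[U [_ <-]]; exact/dimvS/subvf.
case: (ex_maxnP P_ex P_le) => _ /asboolP[U [UL <-]] U_max.
exists U => x; split => [/UL//|Lx].
have /U_max UxU : P (\dim (<[x]> + U)).
  apply/asboolP; exists (<[x]> + U)%VS; split => // y /memv_addP[_ /vlineP[k ->]].
  by move=> [v /UL Lv ->]; exact: L_lin.
have /eqP -> : U == (<[x]> + U)%VS by rewrite eqEdim addvSr.
by apply: (subvP (addvSl _ _)); exact: memv_line.
Qed.

(** [U] is the direction of the affine hull of [S], which becomes a linear subspace
once translated by [- z]. *)
Lemma relative_interior_ball (R : realType) (X : normedVectType R)
    (S : set X) (z : X) : relative_interior S z ->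
  exists (U : {vspace X}) (d : R), [/\ 0 < d,
    forall x, S x -> x - z \in U &
    forall u, u \in U -> `|u| <= d -> S (z + u)].
Proof.
move=> /[dup] /interior_subset Sz; set H := affine_hull S.
have SH : S `<=` H by exact: sub_smallest.
have H_affine : affine_set H.
  by move=> x y t Hx Hy M [M_affine SM]; apply: (M_affine);
    [exact: Hx | exact: Hy].
have Hz := SH z Sz.
move=> riS; have /nbhs_ballP[e /= e0 eS] : within H (nbhs z) S.
  by rewrite (nbhs_subspace_in Hz); exact: riS.
have [||U UE] := @submod_vspace R X [set u | H (z + u)].
- by rewrite /= addr0.
- move=> k x y /= Hx Hy.
  (* An affine set is closed under sums seen from [z] because a sum is twice a
     midpoint: both summands are first dilated by 2 from [z]. *)
  have Hkx : H (z + (2 * k) *: x).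
    rewrite (_ : z + _ = (1 - 2 * k) *: z + (2 * k) *: (z + x)).
      exact: H_affine.
    by rewrite scalerDr addrA -scalerDl subrK scale1r.
  have H2y : H (z + 2 *: y).
    rewrite (_ : z + _ = (1 - 2) *: z + 2 *: (z + y)).
      exact: H_affine.
    by rewrite scalerDr addrA -scalerDl subrK scale1r.
  rewrite (_ : z + _ = (1 - 2^-1) *: (z + (2 * k) *: x) + 2^-1 *: (z + 2 *: y)).
    exact: H_affine.
  rewrite !scalerDr !scalerA addrACA -scalerDl subrK scale1r mulVf// scale1r.
  by congr (_ + (_ *: _ + _)); field.
exists U, (e / 2); split; first by rewrite divr_gt0.
  by move=> x Sx; apply/UE; rewrite /= addrC subrK; exact: SH.
move=> u /UE Hu ud; apply: eS => //.
rewrite -ball_normE /= opprD addNKr normrN (le_lt_trans ud)//.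
by rewrite ltr_pdivrMr// ltr_pMr// ltr1n.
Qed.

Section Regularity.
Context (R : realType) (X : normedVectType R) (dot : {dot X for idfun}).
Hypothesis dot_norm : induces_norm dot.

(** The splitting is chosen linearly in [w], so boundedness of linear maps
provides the constant. *)
Lemma addv_bounded_decomposition (U V : {vspace X}) :
  exists2 K : R, 0 < K & forall w, w \in (U + V)%VS ->
    exists u v, [/\ u \in U, v \in V, w = u + v,
      `|u| <= K * `|w| & `|v| <= K * `|w|].
Proof.
have [K1 K1_gt0 K1_le] := linear_bound dot_norm (addv_pi1 U V).
have [K2 K2_gt0 K2_le] := linear_bound dot_norm (addv_pi2 U V).
exists (Num.max K1 K2); first by rewrite lt_max K1_gt0.
move=> w wUV; exists (addv_pi1 U V w), (addv_pi2 U V w); split.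
- exact: memv_pi1.
- exact: memv_pi2.
- by rewrite addv_pi1_pi2.
- by apply: le_trans (K1_le w) _; rewrite ler_wpM2r// le_max lexx.
- by apply: le_trans (K2_le w) _; rewrite ler_wpM2r// le_max lexx orbT.
Qed.

(** The intersection is reached from [y] by a move proportional to [`|y - x|]: the
common point [x + u = y - v] of the two affine hulls is contracted towards [z] just
enough to fall back into both sets. *)
Lemma relative_interior_regularity (A B : set X) (z : X) (r : R) :
  convex_set A -> convex_set B ->
  relative_interior A z -> relative_interior B z ->
  exists k : R, forall x y, A x -> B y -> `|y - z| <= r ->
    exists2 c, (A `&` B) c & `|y - c| <= k * `|y - x|.
Proof.
move=> A_convex B_convex.
move=> /relative_interior_ball[U [dA [dA_gt0 AU UA]]].
move=> /relative_interior_ball[V [dB [dB_gt0 BV VB]]].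
pose d := Num.min dA dB; have d_gt0 : 0 < d by rewrite lt_min dA_gt0.
have [K K_gt0 decomp] := addv_bounded_decomposition U V.
exists (K * (r / d + 1)) => x y Ax By.
have [yx|yx] := eqVneq y x.
  by move=> yr; exists x; [split=> //; rewrite -yx|rewrite yx subrr normr0 mulr0].
move=> yr; pose t := K * `|y - x|; have t_gt0 : 0 < t.
  by rewrite mulr_gt0// normr_gt0 subr_eq0.
have [|u [v [uU vV yxE u_le v_le]]] := decomp (y - x).
  rewrite (_ : y - x = - (x - z) + (y - z)).
    by rewrite memv_add ?rpredN ?AU ?BV.
  by rewrite opprB [RHS]addrC addrA subrK.
(* This ratio makes [(1 - s) * (d / t) = s], so that the correction [s *: u]
   becomes a vector of norm at most [d] weighted by [1 - s]. *)
pose s := d / (d + t).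
have dt_gt0 : 0 < d + t by rewrite addr_gt0.
have s_ge0 : 0 <= s by rewrite ltW// divr_gt0.
have s_le1 : s <= 1 by rewrite ler_pdivrMr// mul1r lerDl ltW.
have sE : 1 - s = t / (d + t) by rewrite /s; field; rewrite gt_eqF.
have sdt : (1 - s) * (d / t) = s.
  by rewrite sE /s; field; rewrite !gt_eqF.
clearbody s.
pose c := s *: (x + u) + (1 - s) *: z.
have cA : c = s *: x + (1 - s) *: (z + (d / t) *: u).
  by rewrite /c !scalerDr scalerA sdt -addrA [s *: u + _]addrC.
have xuE : x + u = y - v.
  by rewrite -[y](subrK x) yxE addrAC addrK addrC.
have cB : c = s *: y + (1 - s) *: (z + (d / t) *: - v).
  by rewrite /c xuE !scalerDr scalerA sdt -addrA [s *: - v + _]addrC.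
have small (w : X) : `|w| <= K * `|y - x| -> `|(d / t) *: w| <= d.
  move=> w_le; rewrite normrZ gtr0_norm ?divr_gt0//.
  by rewrite mulrAC ler_pdivrMr// ler_pM2l.
exists c.
  split.
    rewrite cA; apply: (convex_setP A_convex) => //; apply: UA.
      by rewrite rpredZ.
    by rewrite (le_trans (small _ u_le))// ge_min lexx.
  rewrite cB; apply: (convex_setP B_convex) => //; apply: VB.
    by rewrite rpredZ// rpredN.
  by rewrite (le_trans (small _ _))// ?normrN// ge_min lexx orbT.
have -> : y - c = (1 - s) *: (y - z) + s *: v.
  rewrite /c xuE scalerBr !scalerBl !scalerBr !scale1r !opprD !opprK.
  by rewrite addrACA [s *: v + _]addrC !addrA [y - s *: y - z]addrAC.
rewrite (le_trans (ler_normD _ _))// !normrZ !ger0_norm ?subr_ge0//.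
have v_le' : s * `|v| <= t.
  by rewrite (le_trans _ v_le)// ler_piMl.
have s1 : (1 - s) * `|y - z| <= t * (r / d).
  rewrite sE -mulrA ler_wpM2l ?(ltW t_gt0)// mulrC ler_pM// ?invr_ge0 ?ltW//.
  by rewrite ltf_pV2 ?posrE// ltrDl.
by rewrite [leRHS]mulrAC -/t mulrDr mulr1 lerD.
Qed.

End Regularity.

(** * Alternating projections *)

Definition interleave (T : Type) (a b : nat -> T) (n : nat) : T :=
  if odd n then b n./2 else a n./2.

Lemma interleave_double (T : Type) (a b : nat -> T) n :
  interleave a b n.*2 = a n.
Proof. by rewrite /interleave odd_double doubleK. Qed.

Lemma interleave_doubleS (T : Type) (a b : nat -> T) n :
  interleave a b n.*2.+1 = b n.
Proof. by rewrite /interleave /= odd_double uphalf_double. Qed.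

Section Subsequence.
Context (R : realType) (X : normedModType R) (z : nat -> X) (f : nat -> nat).
Hypothesis le_f : forall n, (n <= f n)%N.

Lemma cvg_subseq (w : X) : z @ \oo --> w -> z (f n) @[n --> \oo] --> w.
Proof.
move=> /cvgrPdist_lt z_w; apply/cvgrPdist_lt => e /z_w[M _ zM].
by exists M => // n Mn; apply: zM; exact: leq_trans (le_f n).
Qed.

(** The rate is kept because [g ^+ f n <= g ^+ n] when [0 <= g < 1]. *)
Lemma cvg_linearly_subseq (w : X) :
  cvg_linearly z w -> cvg_linearly (fun n => z (f n)) w.
Proof.
move=> [g [m [g0 g1 m0 z_le]]]; exists g, m; split => // n.
by rewrite (le_trans (z_le _))// ler_wpM2l// ler_wiXn2l// ltW.
Qed.

End Subsequence.

Theorem theorem10p21 (R : realType) (X : normedVectType R)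
    (dot : {dot X for idfun}) (dot_norm : induces_norm dot)
    (A B : set X)
    (A_neq0 : A !=set0) (A_closed : closed A) (A_convex : convex_set A)
    (B_neq0 : B !=set0) (B_closed : closed B) (B_convex : convex_set B)
    (AB_neq0 : A `&` B !=set0)
    (b0 : X) (a b : nat -> X)
    (ab_map : alternating_projections A B b0 a b) :
  exists x : X,
    [/\ (A `&` B) x,
        a @ \oo --> x,
        b @ \oo --> x &
        relative_interior A `&` relative_interior B !=set0 ->
          cvg_linearly a x /\ cvg_linearly b x].
Proof.
have [a0 aS bE] := ab_map.
have projA x : nearest_point A x (Defs.proj A x) by exact: proj_nearest.
have projB x : nearest_point B x (Defs.proj B x) by exact: proj_nearest.
have Aa n : A (a n) by case: n => [|n]; rewrite ?a0 ?aS; apply (projA _).1.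
have Bb n : B (b n) by rewrite bE; apply (projB _).1.
pose z := interleave a b.
have z_next n : A (z n) /\ nearest_point B (z n) (z n.+1) \/
                B (z n) /\ nearest_point A (z n) (z n.+1).
  rewrite /z /interleave /= uphalf_half; case: (odd n) => /=.
    by right; split; [exact: Bb | rewrite add1n aS; exact: projA].
  by left; split; [exact: Aa | rewrite add0n bE; exact: projB].
have z_alt n : A (z n) /\ B (z n.+1) \/ B (z n) /\ A (z n.+1).
  by case: (z_next n) => -[? []]; [left | right].
have z_step c n : (A `&` B) c ->
    `|z n.+1 - c| ^+ 2 + `|z n - z n.+1| ^+ 2 <= `|z n - c| ^+ 2.
  by move=> [Ac Bc]; case: (z_next n) => -[_ z_near];
    apply: (nearest_point_pythagoras dot_norm _ z_near).
have [w ABw z_w] := alternating_cvg dot_norm A_closed B_closed z_alt AB_neq0 z_step.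
have le_even n : (n <= n.*2)%N by rewrite -addnn leq_addr.
have le_odd n : (n <= n.*2.+1)%N by exact: leqW.
have aE : a = fun n => z n.*2.
  by apply/funext => n; rewrite /z interleave_double.
have bE' : b = fun n => z n.*2.+1.
  by apply/funext => n; rewrite /z interleave_doubleS.
exists w; split => //.
- by rewrite aE; exact: cvg_subseq z_w.
- by rewrite bE'; exact: cvg_subseq z_w.
move=> [y [yA yB]].
suff z_lin : cvg_linearly z w.
  by rewrite aE bE'; split; exact: cvg_linearly_subseq z_lin.
have [c Cc] := AB_neq0.
(* Regularity holds on bounded sets, and monotonicity confines [z] to one. *)
pose r := `|z 0%N - c| + `|c - y|.
have z_bound n : `|z n - y| <= r.
  rewrite (le_trans (ler_distD c _ _))// lerD2r.
  exact: (fejer_le (square_decrease_fejer z_step) Cc (leq0n n)).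
(* The sets play symmetric roles: [z n] may lie in either of them. *)
have [k1 reg1] := relative_interior_regularity dot_norm r A_convex B_convex yA yB.
have [k2 reg2] := relative_interior_regularity dot_norm r B_convex A_convex yB yA.
apply: (square_decrease_linear (k := Num.max k1 k2) z_step _ _ z_w) => n.
  by apply: (nearest_point_exists dot_norm); [exact: closedI | exists c].
case: (z_alt n) => -[z0 z1].
  have [p [Bp Ap] zp] := reg2 _ _ z1 z0 (z_bound n).
  by exists p => //; rewrite (le_trans zp)// ler_wpM2r// le_max lexx orbT.
have [p ABp zp] := reg1 _ _ z1 z0 (z_bound n).
by exists p => //; rewrite (le_trans zp)// ler_wpM2r// le_max lexx.
Qed.
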